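(* Let $\pi$ be a projective unitary representation of a countable group $G$ on a Hilbert space $H$ such that the commutant $\pi(G)'$ is a finite von Neumann algebra. Assume that $\bigcup_{i=1}^k\{\pi(g)\xi_i\}_{g\in G}$ is a frame for $H$. If $A\in\pi(G)'$ and $\eta_1,\dots,\eta_k\in H$ are Bessel vectors for $\pi$ with $\xi_i=A\eta_i$ for $i=1,\dots,k$, then $A$ is invertible and $\bigcup_{i=1}^k\{\pi(g)\eta_i\}_{g\in G}$ is also a frame for $H$.
   Context: A projective unitary representation of $G$ on $H$ is a map $g\mapsto\pi(g)$ into unitaries with $\pi(g)\pi(h)=\mu(g,h)\pi(gh)$, $\mu:G\times G\to\mathbb{T}$. $\eta$ is a Bessel vector for $\pi$ if $\{\pi(g)\eta\}_{g\in G}$ is a Bessel sequence. *)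

(* Defs.v *)
(* MathComp + MathComp-Analysis (esum) + real_closed complex numbers R[i]. *)
From HB Require Import structures.
From mathcomp Require Import all_boot all_order all_algebra.
From mathcomp Require Import all_classical all_reals all_analysis.
From mathcomp Require Import complex.
Set Implicit Arguments. Unset Strict Implicit. Unset Printing Implicit Defensive.
Import Order.TTheory GRing.Theory Num.Theory.
Local Open Scope ring_scope.
Local Open Scope classical_set_scope.

(* ---------- complex Hilbert spaces ---------- *)

(* squared modulus of a complex number, as a real number *)
Definition cabs2 (R : realType) (z : R[i]) : R := complex.Re (`|z| ^+ 2).

(* inner product, linear in the first variable, conjugate-linear in the second *)
Definition is_inner_product (R : realType) (V : lmodType R[i]) (ip : V -> V -> R[i]) :=
  [/\ (forall (a : R[i]) (x y z : V), ip (a *: x + y) z = a * ip x z + ip y z),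
      (forall x y : V, ip y x = (ip x y)^*),
      (forall x : V, 0 <= ip x x) &
      (forall x : V, ip x x = 0 -> x = 0)].

(* the induced norm ||x|| = sqrt <x,x> *)
Definition hnorm (R : realType) (V : lmodType R[i]) (ip : V -> V -> R[i]) (x : V) : R :=
  Num.sqrt (complex.Re (ip x x)).

(* completeness w.r.t. the induced norm *)
Definition ip_complete (R : realType) (V : lmodType R[i]) (ip : V -> V -> R[i]) :=
  forall u : nat -> V,
    (forall eps : R, 0 < eps -> exists N : nat, forall m n : nat,
        (N <= m)%N -> (N <= n)%N -> hnorm ip (u m - u n) < eps) ->
    exists l : V, forall eps : R, 0 < eps -> exists N : nat, forall n : nat,
        (N <= n)%N -> hnorm ip (u n - l) < eps.

Definition is_hilbert (R : realType) (V : lmodType R[i]) (ip : V -> V -> R[i]) :=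
  is_inner_product ip /\ ip_complete ip.

(* bounded linear operators on H *)
Definition bounded_op (R : realType) (V : lmodType R[i]) (ip : V -> V -> R[i]) (T : V -> V) :=
  (forall (a : R[i]) (x y : V), T (a *: x + y) = a *: T x + T y) /\
  exists M : R, forall x : V, hnorm ip (T x) <= M * hnorm ip x.

(* isometries: V^* V = I, i.e. <Vx,Vy> = <x,y> *)
Definition is_isometry (R : realType) (V : lmodType R[i]) (ip : V -> V -> R[i]) (T : V -> V) :=
  bounded_op ip T /\ forall x y : V, ip (T x) (T y) = ip x y.

(* unitaries: surjective isometries (V^* V = V V^* = I) *)
Definition is_unitary (R : realType) (V : lmodType R[i]) (ip : V -> V -> R[i]) (T : V -> V) :=
  is_isometry ip T /\ forall y : V, exists x : V, T x = y.

(* invertible element of B(H): has a bounded two-sided inverse *)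
Definition invertible_op (R : realType) (V : lmodType R[i]) (ip : V -> V -> R[i]) (T : V -> V) :=
  bounded_op ip T /\
  exists S : V -> V, [/\ bounded_op ip S, (forall x, T (S x) = x) & (forall x, S (T x) = x)].

(* ---------- groups and projective unitary representations ---------- *)

Definition is_group (G : Type) (mul : G -> G -> G) (e : G) (inv : G -> G) :=
  [/\ (forall a b c, mul a (mul b c) = mul (mul a b) c),
      (forall a, mul e a = a), (forall a, mul a e = a),
      (forall a, mul (inv a) a = e) & (forall a, mul a (inv a) = e)].

(* pi(g) unitary and pi(g) pi(h) = mu(g,h) pi(gh) with mu : G x G -> T *)
Definition proj_unitary_rep (R : realType) (V : lmodType R[i]) (ip : V -> V -> R[i])
    (G : Type) (mul : G -> G -> G) (pi : G -> V -> V) :=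
  (forall g, is_unitary ip (pi g)) /\
  exists mu : G -> G -> R[i], (forall g h, `|mu g h| = 1) /\
    forall g h (x : V), pi g (pi h x) = mu g h *: pi (mul g h) x.

(* T belongs to the commutant pi(G)' *)
Definition in_commutant (R : realType) (V : lmodType R[i]) (ip : V -> V -> R[i])
    (G : Type) (pi : G -> V -> V) (T : V -> V) :=
  bounded_op ip T /\ forall g (x : V), T (pi g x) = pi g (T x).

(* The von Neumann algebra pi(G)' is finite: its identity is a finite projection,
   i.e. every isometry W in pi(G)' (W^* W = I) satisfies W W^* = I (is unitary). *)
Definition commutant_finite (R : realType) (V : lmodType R[i]) (ip : V -> V -> R[i])
    (G : Type) (pi : G -> V -> V) :=
  forall W : V -> V, in_commutant ip pi W -> is_isometry ip W -> is_unitary ip W.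

(* ---------- frames and Bessel families ---------- *)

(* sum_{j in I} |<x, f j>|^2 as an extended nonnegative real *)
Definition frame_sum (R : realType) (V : lmodType R[i]) (ip : V -> V -> R[i])
    (I : choiceType) (f : I -> V) (x : V) : \bar R :=
  (\esum_(j in [set: I]) (cabs2 (ip x (f j)))%:E)%E.

Definition is_bessel (R : realType) (V : lmodType R[i]) (ip : V -> V -> R[i])
    (I : choiceType) (f : I -> V) :=
  exists b : R, forall x : V, (frame_sum ip f x <= (b * hnorm ip x ^+ 2)%:E)%E.

Definition is_frame (R : realType) (V : lmodType R[i]) (ip : V -> V -> R[i])
    (I : choiceType) (f : I -> V) :=
  exists a b : R, 0 < a /\ forall x : V,
    ((a * hnorm ip x ^+ 2)%:E <= frame_sum ip f x)%E /\
    (frame_sum ip f x <= (b * hnorm ip x ^+ 2)%:E)%E.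

(* eta is a Bessel vector for pi *)
Definition bessel_vector (R : realType) (V : lmodType R[i]) (ip : V -> V -> R[i])
    (G : choiceType) (pi : G -> V -> V) (eta : V) :=
  is_bessel ip (fun g : G => pi g eta).

(* Main.v *)
Require Import Defs.
From HB Require Import structures.
From mathcomp Require Import all_boot all_order all_algebra.
From mathcomp Require Import all_classical all_reals all_analysis.
From mathcomp Require Import complex.
From mathcomp Require Import ring lra.
Import Order.TTheory GRing.Theory Num.Theory.
Local Open Scope ring_scope.

(* The lower frame bound for [xi = A eta] and the Bessel bound for [eta] make the
   adjoint [B] of [A] bounded below, so [S = A B] has an invertible positive square
   root [K]. The isometric part [B K^-1] of [B] lies in the commutant, hence is
   unitary by finiteness; thus [B], and with it [A], is invertible. The frame
   bounds for [eta] at [x = B z] are those for [xi] at [z]. *)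

Lemma fsbig_finType (S : Type) (idx : S) (op : Monoid.com_law idx) (T : finType)
    (F : T -> S) :
  \big[op/idx]_(i \in [set: T]) F i = \big[op/idx]_i F i.
Proof.
rewrite [RHS]fsbig_seq ?index_enum_uniq//; apply: eq_fsbigl.
by apply/seteqP; split=> i //= _; exact: mem_index_enum.
Qed.

(** * Real inner product geometry of a complex Hilbert space *)

Section InnerProduct.
Variables (R : realType) (V : lmodType R[i]) (ip : V -> V -> R[i]).
Hypothesis ipP : is_inner_product ip.
Local Notation nrm := (hnorm ip).

(** The real part is a real inner product with the same norm, so estimates become real arithmetic
    within reach of [lra] and [nra]. *)
Definition rip (x y : V) : R := complex.Re (ip x y).

Definition rscale (t : R) (x : V) : V := (t%:C)%C *: x.

Lemma ReM_real (t : R) (z : R[i]) : complex.Re ((t%:C)%C * z) = t * complex.Re z.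
Proof. by case: z => a b /=; rewrite mul0r subr0. Qed.

Lemma ipDl x y z : ip (x + y) z = ip x z + ip y z.
Proof. by case: ipP => l _ _ _; rewrite -[x in LHS]scale1r l mul1r. Qed.

Lemma ip0l z : ip 0 z = 0.
Proof. by apply: (addrI (ip 0 z)); rewrite -ipDl !addr0. Qed.

Lemma ipZl a x z : ip (a *: x) z = a * ip x z.
Proof. by case: ipP => l _ _ _; rewrite -[a *: x]addr0 l ip0l addr0. Qed.

Lemma ip_conj x y : ip y x = (ip x y)^*.
Proof. by case: ipP. Qed.

Lemma ripC x y : rip x y = rip y x.
Proof. by rewrite /rip ip_conj; case: (ip y x). Qed.

Lemma ripDl x y z : rip (x + y) z = rip x z + rip y z.
Proof. by rewrite /rip ipDl; case: (ip x z); case: (ip y z). Qed.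

Lemma ripZl t x z : rip (rscale t x) z = t * rip x z.
Proof. by rewrite /rip ipZl ReM_real. Qed.

Lemma ripNl x z : rip (- x) z = - rip x z.
Proof. by rewrite -scaleN1r /rip ipZl mulN1r; case: (ip x z). Qed.

Lemma ripDr x y z : rip x (y + z) = rip x y + rip x z.
Proof. by rewrite ripC ripDl !(ripC x). Qed.

Lemma ripZr t x z : rip x (rscale t z) = t * rip x z.
Proof. by rewrite ripC ripZl ripC. Qed.

Lemma ripNr x z : rip x (- z) = - rip x z.
Proof. by rewrite ripC ripNl ripC. Qed.

Definition ripE := (ripDl, ripDr, ripNl, ripNr, ripZl, ripZr).

Lemma rip_ge0 x : 0 <= rip x x.
Proof. by case: ipP => _ _ /(_ x) + _; rewrite lecE => /andP[]. Qed.

Lemma rip_eq0 x : rip x x = 0 -> x = 0.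
Proof.
case: ipP => _ _ /(_ x) p /(_ x) + r0; apply.
move: p; rewrite lecE => /andP[/eqP im _].
by move: r0 im; rewrite /rip; case: (ip x x) => a b /= -> ->.
Qed.

(** Multiplication by ['i] turns the imaginary part into a real part; complex identities thus reduce
    to identities for [rip]. *)
Lemma Im_ip x y : complex.Im (ip x y) = - rip ('i%C *: x) y.
Proof. by rewrite /rip ipZl; case: (ip x y) => a b /=; rewrite mul0r sub0r mul1r opprK. Qed.

Lemma complex_ext (z w : R[i]) :
  complex.Re z = complex.Re w -> complex.Im z = complex.Im w -> z = w.
Proof. by case: z w => [a b] [c d] /= -> ->. Qed.

Lemma rip_inj x y : (forall z, rip z x = rip z y) -> x = y.
Proof.
move=> h; apply/subr0_eq/rip_eq0; have := h (x - y).
by rewrite ripDr ripNr => ->; rewrite subrr.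
Qed.

Lemma hnorm_sq x : nrm x ^+ 2 = rip x x.
Proof. by rewrite /hnorm sqr_sqrtr// rip_ge0. Qed.

Lemma hnorm_ge0 x : 0 <= nrm x.
Proof. exact: sqrtr_ge0. Qed.

Lemma hnorm_eq0 x : nrm x = 0 -> x = 0.
Proof. by move=> h; apply: rip_eq0; rewrite -hnorm_sq h expr0n. Qed.

Lemma hnorm0 : nrm 0 = 0.
Proof. by rewrite /hnorm ip0l sqrtr0. Qed.

Lemma hnormN x : nrm (- x) = nrm x.
Proof. by rewrite /hnorm -/(rip _ _) ripNl ripNr opprK. Qed.

Lemma hnorm_sub x y : nrm (x - y) = nrm (y - x).
Proof. by rewrite -hnormN opprB. Qed.

Lemma hnorm_rscale t x : 0 <= t -> nrm (rscale t x) = t * nrm x.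
Proof.
move=> t0; rewrite /hnorm -/(rip _ _) ripZl ripZr mulrA -expr2.
by rewrite sqrtrM ?sqr_ge0// sqrtr_sqr ger0_norm.
Qed.

Lemma hnorm_le a x : 0 <= a -> rip x x <= a ^+ 2 -> nrm x <= a.
Proof. by move=> a0; rewrite -hnorm_sq ler_pXn2r// nnegrE ?hnorm_ge0. Qed.

(** Expanding the square of [nrm y * x - nrm x * y] gives the inequality multiplied by
    [2 * nrm x * nrm y]; the case where this factor vanishes is split off. The form is one-sided:
    the other sign comes from [- x]. *)
Lemma cauchy_schwarz x y : rip x y <= nrm x * nrm y.
Proof.
have := rip_ge0 (rscale (nrm y) x - rscale (nrm x) y).
rewrite !ripE -!hnorm_sq (ripC y x) => h.
have [/hnorm_eq0 ->|x0] := eqVneq (nrm x) 0.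
  by rewrite /rip ip0l hnorm0 mul0r.
have [/hnorm_eq0 ->|y0] := eqVneq (nrm y) 0.
  by rewrite ripC /rip ip0l hnorm0 mulr0.
have xp : 0 < nrm x by rewrite lt_def x0 hnorm_ge0.
have yp : 0 < nrm y by rewrite lt_def y0 hnorm_ge0.
rewrite -(ler_pM2l (mulr_gt0 xp yp)).
lra.
Qed.

Lemma hnormD x y : nrm (x + y) <= nrm x + nrm y.
Proof.
apply: hnorm_le; first by rewrite addr_ge0 ?hnorm_ge0.
rewrite !ripE (ripC y) -!hnorm_sq; have := cauchy_schwarz x y; lra.
Qed.

Lemma hnormB_le x y z : nrm (x - z) <= nrm (x - y) + nrm (y - z).
Proof. by apply: le_trans (hnormD _ _); rewrite addrA subrK. Qed.

(** * Norm convergence and passage to the limit *)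

Definition cvgto (u : nat -> V) (l : V) := forall eps : R, 0 < eps ->
  exists N : nat, forall n : nat, (N <= n)%N -> nrm (u n - l) < eps.

Lemma cvgto_dominated (u u' v : nat -> V) l l' m (K : R) :
  cvgto u l -> cvgto u' l' ->
  (forall n, nrm (v n - m) <= K * (nrm (u n - l) + nrm (u' n - l'))) ->
  cvgto v m.
Proof.
move=> ul ul' h eps e0.
(* [K] may have any sign, so it is replaced by the positive [|K| + 1]; two errors below [d] then add
   up to less than [eps]. *)
pose d := eps / (2 * (`|K| + 1)).
have K1 : 0 < `|K| + 1 by rewrite ltr_wpDl.
have d0 : 0 < d by rewrite divr_gt0// mulr_gt0.
have [N hN] := ul _ d0; have [N' hN'] := ul' _ d0.
exists (maxn N N') => n; rewrite geq_max => /andP[n1 n2].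
have a1 := hN _ n1; have a2 := hN' _ n2; apply: le_lt_trans (h n) _.
have s0 : 0 <= nrm (u n - l) + nrm (u' n - l') by rewrite addr_ge0 ?hnorm_ge0.
have -> : eps = (`|K| + 1) * (2 * d).
  by rewrite /d; field; rewrite gt_eqF.
apply: (@le_lt_trans _ _ ((`|K| + 1) * (nrm (u n - l) + nrm (u' n - l')))).
  by apply: ler_wpM2r => //; have := ler_norm K; lra.
by rewrite ltr_pM2l//; lra.
Qed.

Lemma cvgto_rip (u : nat -> V) l x (e : R) : cvgto u l -> 0 < e ->
  exists N : nat, forall n : nat, (N <= n)%N -> `|rip (u n) x - rip l x| <= e.
Proof.
move=> ul e0; have x0 := hnorm_ge0 x; have x1 := ltr_wpDl x0 (@ltr01 R).
have [N hN] := ul (e / (nrm x + 1)) (divr_gt0 e0 x1).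
exists N => n /hN {}hN.
have le : nrm (u n - l) * nrm x <= e.
  have -> : e = e / (nrm x + 1) * (nrm x + 1) by rewrite divfK// gt_eqF.
  by apply: ler_pM => //; [exact: hnorm_ge0|exact: ltW|lra].
have := cauchy_schwarz (u n - l) x; have := cauchy_schwarz (- (u n - l)) x.
rewrite hnormN !ripE ler_norml => *; lra.
Qed.

Lemma cvgto_rip_ge0 (u : nat -> V) l (f : R) x N :
  cvgto u l -> (forall n, (N <= n)%N -> 0 <= rip (u n) x + f) -> 0 <= rip l x + f.
Proof.
move=> ul h; apply/ler_addgt0Pr => e e0.
have [M hM] := cvgto_rip u l x e ul e0.
have := hM _ (leq_maxr N M); have := h _ (leq_maxl N M).
by rewrite ler_norml; lra.
Qed.

Lemma cvgto_rip_eq (u u' : nat -> V) l l' x x' : cvgto u l -> cvgto u' l' ->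
  (forall n, rip (u n) x = rip (u' n) x') -> rip l x = rip l' x'.
Proof.
move=> ul ul' h; apply/eqP; rewrite -subr_eq0 -normr_eq0 eq_le normr_ge0 andbT.
apply/ler_addgt0Pr => e e0; have e2 : 0 < e / 2 by rewrite divr_gt0.
have [N hN] := cvgto_rip _ _ x _ ul e2; have [M hM] := cvgto_rip _ _ x' _ ul' e2.
have := hN _ (leq_maxl N M); have := hM _ (leq_maxr N M); rewrite h !ler_norml.
lra.
Qed.

Lemma Im_ipr x y : complex.Im (ip x y) = rip x ('i%C *: y).
Proof. by rewrite ip_conj ripC -[rip _ _]opprK -Im_ip; case: (ip y x). Qed.

Lemma cvgto_ip_eq (u u' : nat -> V) l l' x y : cvgto u l -> cvgto u' l' ->
  (forall n, ip (u n) y = ip x (u' n)) -> ip l y = ip x l'.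
Proof.
move=> ul ul' h; apply: complex_ext.
  rewrite -[LHS]/(rip l y) -[RHS]/(rip x l') [RHS]ripC.
  by apply: cvgto_rip_eq ul ul' _ => n; rewrite [RHS]ripC /rip h.
rewrite Im_ipr Im_ip -ripNl ripC [RHS]ripC ripC.
by apply: cvgto_rip_eq ul ul' _ => n; rewrite -Im_ipr h Im_ip -ripNl ripC.
Qed.

Lemma cvgto_unique u l m : cvgto u l -> cvgto u m -> l = m.
Proof.
move=> ul um; apply/subr0_eq/hnorm_eq0/eqP; rewrite eq_le hnorm_ge0 andbT.
apply/ler_addgt0Pr => e e0; rewrite add0r.
have e2 : 0 < e / 2 by rewrite divr_gt0.
have [N hN] := ul _ e2; have [M hM] := um _ e2.
have := hN _ (leq_maxl N M); have := hM _ (leq_maxr N M).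
rewrite hnorm_sub => a b.
have := hnormB_le l (u (maxn N M)) m; rewrite hnorm_sub in b.
rewrite (hnorm_sub m) in a; lra.
Qed.

(** * Consequences of completeness: geometric sequences and Riesz representation *)

Hypothesis ipC : ip_complete ip.

Lemma geometric_cvgto (u : nat -> V) (K q : R) : 0 <= q -> q < 1 ->
  (forall n, nrm (u n.+1 - u n) <= K * q ^+ n) -> exists l, cvgto u l.
Proof.
move=> q0 q1 h; apply: ipC.
(* The exact partial geometric sum closes the induction on [k]; it is weakened to a bound uniform in
   [k] afterwards. *)
have hk n k : nrm (u (n + k)%N - u n) <= K * q ^+ n * (1 - q ^+ k) / (1 - q).
  elim: k => [|k IH]; first by rewrite addn0 subrr hnorm0 expr0 subrr mulr0 mul0r.
  apply: le_trans (hnormB_le _ (u (n + k)%N) _) _.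
  rewrite addnS; apply: le_trans (lerD (h _) IH) _.
  rewrite le_eqVlt; apply/orP; left; apply/eqP.
  by rewrite exprD exprS; field; rewrite subr_eq0 gt_eqF.
have K0 : 0 <= K by have := h 0%N; rewrite expr0 mulr1; apply: le_trans; exact: hnorm_ge0.
have {}hk n k : nrm (u (n + k)%N - u n) <= K / (1 - q) * q ^+ n.
  apply: le_trans (hk _ _) _; rewrite [leRHS]mulrAC ler_wpM2r//.
    by rewrite invr_ge0 subr_ge0 (ltW q1).
  by rewrite ler_piMr ?mulr_ge0 ?exprn_ge0// lerBlDr lerDl exprn_ge0.
move=> eps e0.
have C0 : 0 <= K / (1 - q) by rewrite divr_ge0 ?subr_ge0 ?(ltW q1).
(* The [+ 1] keeps the denominator positive when [K = 0]. Both [u m] and [u n] will be within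
   [eps / 2] of [u N]. *)
pose d := eps / (2 * (K / (1 - q) + 1)).
have d0 : 0 < d by rewrite divr_gt0// mulr_gt0// ltr_wpDl.
have qn : `|q| < 1 by rewrite ger0_norm.
have /cvgrPdist_lt/(_ d d0)[N _ hN] := cvg_expr qn; exists N => m n mN nN.
have dN : K / (1 - q) * q ^+ N < eps / 2.
  have := hN N (leqnn N); rewrite sub0r normrN ger0_norm ?exprn_ge0// => qd.
  have -> : eps / 2 = (K / (1 - q) + 1) * d.
    by rewrite /d; move: C0; set c := K / _ => C0; field; rewrite gt_eqF//; lra.
  apply: (@le_lt_trans _ _ ((K / (1 - q) + 1) * q ^+ N)).
    by rewrite ler_wpM2r ?exprn_ge0//; lra.
  by rewrite ltr_pM2l// ltr_wpDl.
apply: le_lt_trans (hnormB_le _ (u N) _) _.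
have := hk N (m - N)%N; have := hk N (n - N)%N; rewrite !subnKC// (hnorm_sub (u n)).
lra.
Qed.

(** The representing vector [l] minimizes [q x = rip x x - 2 * Re (f x)], which equals the squared
    distance from [x] to [l] up to a constant. *)
Lemma riesz (f : V -> R[i]) (M : R) :
  (forall a x y, f (a *: x + y) = a * f x + f y) ->
  (forall x, complex.Re (f x) <= M * nrm x) ->
  exists l, forall x, f x = ip x l.
Proof.
move=> fl fM; pose rf x := complex.Re (f x).
have fD x y : f (x + y) = f x + f y by rewrite -[x in LHS]scale1r fl mul1r.
have f0 : f 0 = 0 by apply: (addrI (f 0)); rewrite -fD !addr0.
have fZ a x : f (a *: x) = a * f x by rewrite -[a *: x]addr0 fl f0 addr0.
have rfD x y : rf (x + y) = rf x + rf y.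
  by rewrite /rf fD; case: (f x); case: (f y).
have rfZ t x : rf (rscale t x) = t * rf x by rewrite /rf fZ ReM_real.
pose q x := rip x x - 2 * rf x.
(* Complete the square in [nrm x]. *)
have q_lb x : - M ^+ 2 <= q x.
  have := fM x; rewrite /q /rf -hnorm_sq; have := sqr_ge0 (nrm x - M); nra.
have lbE : has_lbound (range q) by exists (- M ^+ 2) => _ [x _ <-].
have infE : has_inf (range q) by split => //; exists (q 0); exists 0.
pose m := inf (range q).
have mq x : m <= q x by apply: ge_inf => //; exists x.
have /choice[u hu] : forall n : nat, exists x, q x < m + n.+1%:R^-1.
  move=> n; have n0 : (0 : R) < n.+1%:R^-1 by rewrite invr_gt0 ltr0n.
  by have [_ [x _ <-] hx] := inf_adherent n0 infE; exists x.
(* By the parallelogram law the left side is [2 q(x) + 2 q(y) - 4 q((x + y) / 2)]. Hence minimizing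
   sequences are Cauchy. *)
have para x y : rip (x - y) (x - y) <= 2 * (q x - m) + 2 * (q y - m).
  have := mq (rscale 2^-1 (x + y)).
  rewrite /q !ripE rfZ rfD (ripC y x); lra.
have small (e : R) : 0 < e -> exists N : nat, forall n, (N <= n)%N -> q (u n) < m + e.
  move=> e0; exists (Num.trunc e^-1) => n hn; apply: lt_le_trans (hu n) _.
  rewrite lerD2l -[e]invrK lef_pV2 ?posrE ?ltr0n ?invr_gt0//.
  by apply: ltW; apply: lt_le_trans (truncnS_gt _) _; rewrite ler_nat.
have [l ul] : exists l, cvgto u l.
  apply: ipC => eps e0.
  have [N hN] := small (eps ^+ 2 / 4) (divr_gt0 (exprn_gt0 _ e0) (ltr0n _ 4)).
  exists N => i j /hN hi /hN hj.
  rewrite -(@ltr_pXn2r _ 2) ?nnegrE ?hnorm_ge0 ?ltW// hnorm_sq.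
  have := para (u i) (u j); lra.
(* First variation: [q (u n + t y)] is at least [m], and [q (u n)] is at most [m + e]; let [n] grow,
   then [e] shrink. *)
have var y t : 0 <= 2 * t * (rip l y - rf y) + t ^+ 2 * rip y y.
  apply/ler_addgt0Pr => e e0; have [N hN] := small e e0.
  suff : 0 <= rip l (rscale (2 * t) y) + (- 2 * t * rf y + t ^+ 2 * rip y y + e).
    by rewrite ripZr; lra.
  apply: (cvgto_rip_ge0 u l _ _ N ul) => n /hN.
  have := mq (u n + rscale t y); rewrite /q !ripE rfD rfZ (ripC y (u n)); lra.
have rl y : rip l y = rf y.
  apply: subr0_eq; set z := _ - _; have y0 := rip_ge0 y.
  (* This is nearly the minimizing [t], with [+ 1] guarding against [y = 0]. With
     [z = w (rip y y + 1)] the inequality becomes [- w^2 (rip y y + 2) >= 0], which forces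
     [w = 0]. *)
  have := var y (- z / (rip y y + 1)); rewrite -/z.
  have y1 : 0 < rip y y + 1 by lra.
  set w := z / (rip y y + 1); have zw : z = w * (rip y y + 1) by rewrite divfK ?gt_eqF.
  rewrite mulNr -/w zw => h.
  have : w ^+ 2 * (rip y y + 2) <= 0 by nra.
  rewrite pmulr_lle0; last lra.
  rewrite expr2 => w2; have /eqP : w ^+ 2 = 0 by apply/eqP; rewrite eq_le sqr_ge0 expr2 w2.
  by rewrite sqrf_eq0 => /eqP ->; rewrite mul0r.
exists l => x; apply: complex_ext; first by rewrite -/(rip _ _) ripC rl.
by rewrite Im_ip ripC rl /rf fZ; case: (f x) => a b /=; rewrite mul0r mul1r sub0r opprK.
Qed.

Lemma ip_inj x y : (forall z, ip z x = ip z y) -> x = y.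
Proof. by move=> h; apply: rip_inj => z; rewrite /rip h. Qed.

Lemma ip_linr a x y z : ip z (a *: x + y) = a^* * ip z x + ip z y.
Proof. by rewrite ip_conj ipDl ipZl rmorphD rmorphM /= -(ip_conj x) -(ip_conj y). Qed.

Lemma ipDr x y z : ip z (x + y) = ip z x + ip z y.
Proof. by rewrite -[x in LHS]scale1r ip_linr rmorph1 mul1r. Qed.

Lemma ipNl x z : ip (- x) z = - ip x z.
Proof. by rewrite -scaleN1r ipZl mulN1r. Qed.

Lemma ipNr x z : ip z (- x) = - ip z x.
Proof. by rewrite ip_conj ipNl rmorphN /= -(ip_conj x). Qed.

Lemma ip_rscalel t x z : ip (rscale t x) z = (t%:C)%C * ip x z.
Proof. exact: ipZl. Qed.

Lemma ip_rscaler t x z : ip z (rscale t x) = (t%:C)%C * ip z x.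
Proof.
rewrite ip_conj ip_rscalel rmorphM /= -(ip_conj x); congr (_ * _).
by apply: complex_ext => //=; rewrite oppr0.
Qed.

(** * Linear maps, adjoints and bounded inverses *)

Definition is_linear_map (T : V -> V) :=
  forall (a : R[i]) (x y : V), T (a *: x + y) = a *: T x + T y.

Lemma lin_add T x y : is_linear_map T -> T (x + y) = T x + T y.
Proof. by move=> l; rewrite -[x in LHS]scale1r l scale1r. Qed.

Lemma lin_zero T : is_linear_map T -> T 0 = 0.
Proof. by move=> l; apply: (addrI (T 0)); rewrite -lin_add// !addr0. Qed.

Lemma lin_scale T a x : is_linear_map T -> T (a *: x) = a *: T x.
Proof. by move=> l; rewrite -[a *: x]addr0 l lin_zero// addr0. Qed.

Lemma lin_opp T x : is_linear_map T -> T (- x) = - T x.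
Proof. by move=> l; rewrite -scaleN1r lin_scale// scaleN1r. Qed.

Lemma lin_sub T x y : is_linear_map T -> T (x - y) = T x - T y.
Proof. by move=> l; rewrite lin_add// lin_opp. Qed.

(** The pairing separates vectors, so linearity comes for free from an adjoint relation. The
    operators built below for the square root get theirs from self-adjointness. *)
Lemma adjoint_linear (T B : V -> V) :
  (forall x y, ip (T x) y = ip x (B y)) -> is_linear_map B.
Proof. by move=> h a x y; apply: ip_inj => z; rewrite -h !ip_linr !h. Qed.

Lemma adjoint_sym (T B : V -> V) :
  (forall x y, ip (T x) y = ip x (B y)) -> forall x y, ip (B x) y = ip x (T y).
Proof. by move=> h x y; rewrite ip_conj -h -ip_conj. Qed.

Lemma bounded_op_pos T : bounded_op ip T ->
  exists2 M : R, 0 < M & forall x, nrm (T x) <= M * nrm x.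
Proof.
case=> _ [M hM]; exists (`|M| + 1); first by rewrite ltr_wpDl.
move=> x; apply: le_trans (hM x) _; apply: ler_wpM2r; first exact: hnorm_ge0.
have := ler_norm M; lra.
Qed.

Lemma adjoint_exists T : bounded_op ip T ->
  exists2 B, bounded_op ip B & forall x y, ip (T x) y = ip x (B y).
Proof.
move=> bT; have [M M0 hM] := bounded_op_pos T bT; case: bT => lT _.
have /choice[B hB] : forall y, exists l, forall x, ip (T x) y = ip x l.
  move=> y; apply: (riesz _ (M * nrm y)) => [a x x'|x].
    by rewrite lT ipDl ipZl.
  apply: le_trans (cauchy_schwarz (T x) y) _; rewrite mulrAC.
  by apply: ler_wpM2r; rewrite ?hnorm_ge0.
have {}hB x y : ip (T x) y = ip x (B y) by [].
exists B => //; split; first exact: adjoint_linear hB.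
exists M => y; have [->|By0] := eqVneq (nrm (B y)) 0.
  by rewrite mulr_ge0 ?hnorm_ge0// ltW.
have By : 0 < nrm (B y) by rewrite lt_def By0 hnorm_ge0.
(* The square of [nrm (B y)] is [rip (T (B y)) y], at most [M * nrm (B y) * nrm y]; one factor
   [nrm (B y)] cancels. *)
rewrite -(ler_pM2l By) -expr2 hnorm_sq /rip -hB.
apply: le_trans (cauchy_schwarz _ _) _; rewrite mulrA [nrm (B y) * M]mulrC.
by apply: ler_wpM2r; rewrite ?hnorm_ge0.
Qed.

(** The lower bound gives injectivity and, applied at [L x], the bound [c^-1] for the inverse. *)
Lemma bounded_inverse T (c : R) : is_linear_map T -> 0 < c ->
  (forall x, c * nrm x <= nrm (T x)) -> (forall y, exists x, T x = y) ->
  exists L, [/\ bounded_op ip L, forall x, T (L x) = x & forall x, L (T x) = x].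
Proof.
move=> lT c0 low /choice[L TL].
have injT x y : T x = T y -> x = y.
  move=> e; apply/subr0_eq/hnorm_eq0/eqP; rewrite eq_le hnorm_ge0 andbT.
  by rewrite -(pmulr_rle0 _ c0) (le_trans (low _))// lin_sub// e subrr hnorm0.
exists L; split=> //; last by move=> x; apply: injT; rewrite TL.
split; first by move=> a x y; apply: injT; rewrite lT !TL.
exists c^-1 => x; rewrite mulrC ler_pdivlMr// mulrC.
by rewrite -[x in leRHS]TL.
Qed.

Lemma rscaleA s t x : rscale s (rscale t x) = rscale (s * t) x.
Proof. by rewrite /rscale scalerA -rmorphM. Qed.

Lemma rscale1 x : rscale 1 x = x.
Proof. exact: scale1r. Qed.

Lemma lin_rscale T t x : is_linear_map T -> T (rscale t x) = rscale t (T x).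
Proof. exact: lin_scale. Qed.

(** * Square roots of positive operators *)

Fixpoint sqrt_iter (D : V -> V) (n : nat) : V -> V :=
  if n is n'.+1 then fun x => rscale 2^-1 (D x + sqrt_iter D n' (sqrt_iter D n' x))
  else fun=> 0.

Lemma sqrt_iter_adj D n : (forall x y, ip (D x) y = ip x (D y)) ->
  forall x y, ip (sqrt_iter D n x) y = ip x (sqrt_iter D n y).
Proof.
move=> hD; elim: n => [|n IH] x y /=; first by rewrite ip0l ip_conj ip0l rmorph0.
by rewrite ip_rscalel ip_rscaler ipDl ipDr hD !IH.
Qed.

Lemma sqrt_iter_comm D n U : is_linear_map U -> (forall x, U (D x) = D (U x)) ->
  forall x, U (sqrt_iter D n x) = sqrt_iter D n (U x).
Proof.
move=> lU UD; elim: n => [|n IH] x /=; first exact: lin_zero.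
by rewrite lin_rscale// lin_add// UD !IH.
Qed.

(* The map [Y |-> (D + Y^2) / 2] is a contraction of the ball of radius
   [q = 1 - sqrt (1 - r)], the smaller root of [2 q = r + q^2]; its fixed point
   satisfies [(1 - Y)^2 = 1 - D]. *)
Lemma sqrt_fixpoint (D : V -> V) (r : R) : 0 <= r -> r < 1 ->
  (forall x, nrm (D x) <= r * nrm x) -> (forall x y, ip (D x) y = ip x (D y)) ->
  exists Y q, [/\ q < 1, forall x, nrm (Y x) <= q * nrm x,
    forall x y, ip (Y x) y = ip x (Y y),
    forall x, Y x = rscale 2^-1 (D x + Y (Y x)) &
    forall U, bounded_op ip U -> (forall x, U (D x) = D (U x)) ->
      forall x, U (Y x) = Y (U x)].
Proof.
move=> r0 r1 hD sD.
have [q [q0 q1 qr]] : exists q : R, [/\ 0 <= q, q < 1 & 2 * q = r + q ^+ 2].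
  have w0 := sqrtr_ge0 (1 - r).
  have w2 : Num.sqrt (1 - r) ^+ 2 = 1 - r by rewrite sqr_sqrtr//; lra.
  have wp : 0 < Num.sqrt (1 - r) by rewrite sqrtr_gt0; lra.
  by exists (1 - Num.sqrt (1 - r)); split; nra.
pose Yn := sqrt_iter D.
have sY n : forall x y, ip (Yn n x) y = ip x (Yn n y) by exact: sqrt_iter_adj.
have lY n : is_linear_map (Yn n) by exact: adjoint_linear (sY n).
have bY n x : nrm (Yn n x) <= q * nrm x.
  elim: n x => [|n IH] x; first by rewrite hnorm0 mulr_ge0 ?hnorm_ge0.
  rewrite /Yn /= hnorm_rscale ?invr_ge0// -/Yn.
  have := hnormD (D x) (Yn n (Yn n x)); have := hD x.
  have := IH (Yn n x); have := ler_wpM2l q0 (IH x); have := hnorm_ge0 x.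
  have -> : q = 2^-1 * (r + q ^+ 2) by lra.
  nra.
have dY n x : nrm (Yn n.+1 x - Yn n x) <= q * nrm x * q ^+ n.
  elim: n x => [|n IH] x.
    rewrite /Yn /= addr0 subr0 expr0 hnorm_rscale ?invr_ge0//.
    have := hD x; have := hnorm_ge0 x; nra.
  (* Factor a difference of squares as [P^2 - Q^2 = P (P - Q) + (P - Q) Q], valid without
     commutation. Each summand is bounded by [q] times the previous bound, and the factor [1/2]
     absorbs the doubling. *)
  have -> : Yn n.+2 x - Yn n.+1 x =
      rscale 2^-1 (Yn n.+1 (Yn n.+1 x - Yn n x) + (Yn n.+1 (Yn n x) - Yn n (Yn n x))).
    rewrite [Yn n.+1 (_ - _)]lin_sub// addrA subrK.
    rewrite [in LHS]/Yn /= -/Yn /rscale -scalerBr opprD addrACA subrr add0r.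
    by rewrite /Yn.
  rewrite hnorm_rscale ?invr_ge0//.
  have h1 := hnormD (Yn n.+1 (Yn n.+1 x - Yn n x)) (Yn n.+1 (Yn n x) - Yn n (Yn n x)).
  have h2 := bY n.+1 (Yn n.+1 x - Yn n x).
  have h3 := ler_wpM2l q0 (IH x); have h4 := IH (Yn n x).
  have h5 : q * nrm (Yn n x) * q ^+ n <= q * (q * nrm x) * q ^+ n.
    by rewrite ler_wpM2r ?exprn_ge0// ler_wpM2l// bY.
  have -> : q * nrm x * q ^+ n.+1 = q * (q * nrm x) * q ^+ n by rewrite exprS; ring.
  have e : q * (q * nrm x * q ^+ n) = q * (q * nrm x) * q ^+ n by ring.
  lra.
have /choice[Y hY] : forall x, exists l, cvgto (fun n => Yn n x) l.
  by move=> x; apply: (geometric_cvgto _ (q * nrm x) q).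
(* The iterates are uniformly 1-Lipschitz, so [Yn n (Yn n x)] converges to [Y (Y x)]. *)
have YnY n x x' : nrm (Yn n x - Yn n x') <= nrm (x - x').
  rewrite -lin_sub//; apply: le_trans (bY _ _) _.
  by rewrite ler_piMl ?hnorm_ge0// ltW.
exists Y, q; split => //.
- move=> x; apply/ler_addgt0Pr => e e0; have [N hN] := hY x e e0.
  have := hN _ (leqnn N); rewrite hnorm_sub; have := bY N x.
  have := hnormD (Y x - Yn N x) (Yn N x); rewrite subrK; lra.
- by move=> x y; apply: cvgto_ip_eq (hY x) (hY y) _ => n; exact: sY.
(* The shifted sequence tends to [Y x], and by the recursion also to the right-hand side. *)
- move=> x; apply: (cvgto_unique (fun n => Yn n.+1 x)).
    move=> e e0; have [N hN] := hY x e e0.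
    by exists N => n nN; apply: hN; exact: leqW.
  apply: (cvgto_dominated _ _ _ _ _ _ 1 (hY x) (hY (Y x))) => n.
  rewrite /Yn /= -/Yn /rscale -scalerBr opprD addrACA subrr add0r -/(rscale _ _).
  rewrite hnorm_rscale ?invr_ge0// mul1r.
  have := hnormB_le (Yn n (Yn n x)) (Yn n (Y x)) (Y (Y x)).
  have := YnY n (Yn n x) (Y x).
  have := hnorm_ge0 (Yn n (Yn n x) - Y (Y x)); rewrite /Yn; lra.
- move=> U bU UD x; have [M M0 hM] := bounded_op_pos U bU; case: bU => lU _.
  apply: (cvgto_unique (fun n => Yn n (U x))); last exact: hY.
  apply: (cvgto_dominated _ _ _ _ _ _ M (hY x) (hY x)) => n.
  rewrite /Yn -sqrt_iter_comm// -lin_sub//; apply: le_trans (hM _) _.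
  by rewrite ler_wpM2l ?(ltW M0)// lerDl hnorm_ge0.
Qed.

(** Neumann series: iterating [x |-> y + Y x] from [0] produces its partial sums, and the limit is a
    fixed point. *)
Lemma neumann_surjective Y (q : R) : is_linear_map Y -> q < 1 ->
  (forall x, nrm (Y x) <= q * nrm x) -> forall y, exists x, x - Y x = y.
Proof.
(* The sign of [q] is unknown, while [geometric_cvgto] asks for a nonnegative ratio. *)
move=> lY q1 bY y; pose p := Num.max 0 q.
have p0 : 0 <= p by rewrite le_max lexx.
have p1 : p < 1 by rewrite gt_max ltr01.
have {}bY x : nrm (Y x) <= p * nrm x.
  by apply: le_trans (bY x) _; rewrite ler_wpM2r ?hnorm_ge0// le_max lexx orbT.
pose u n := iter n (fun x => y + Y x) 0.
have du n : nrm (u n.+1 - u n) <= nrm y * p ^+ n.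
  elim: n => [|n IH]; first by rewrite /u /= lin_zero// addr0 subr0 expr0 mulr1.
  have -> : u n.+2 - u n.+1 = Y (u n.+1 - u n).
    by rewrite lin_sub// [LHS]/= opprD addrACA subrr add0r.
  by apply: le_trans (bY _) _; rewrite exprS mulrCA ler_wpM2l.
have [l ul] := geometric_cvgto u _ p p0 p1 du.
exists l; apply/eqP; rewrite subr_eq; apply/eqP.
apply: (cvgto_unique (fun n => u n.+1)).
  move=> e e0; have [N hN] := ul e e0.
  by exists N => n nN; apply: hN; exact: leqW.
apply: (cvgto_dominated _ _ _ _ _ _ 1 ul ul) => n.
rewrite /u /= -/(u n) opprD addrACA subrr add0r -lin_sub//.
apply: le_trans (bY _) _; have := hnorm_ge0 (u n - l); nra.
Qed.

(** For small [t > 0] the operator [D = 1 - t S] has norm below 1. The fixed point [Y] then gives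
    [(1 - Y)^2 = t S], so [K = t^(-1/2) (1 - Y)]; it is invertible because [Y] is a strict
    contraction. *)
Lemma positive_sqrt S (c : R) : bounded_op ip S -> 0 < c ->
  (forall x y, ip (S x) y = ip x (S y)) ->
  (forall x, c * nrm x ^+ 2 <= rip (S x) x) ->
  exists K L, [/\ bounded_op ip L,
    forall x y, ip (K x) y = ip x (K y),
    forall x, K (K x) = S x,
    (forall x, K (L x) = x) /\ (forall x, L (K x) = x) &
    forall U, bounded_op ip U -> (forall x, U (S x) = S (U x)) ->
      forall x, U (K x) = K (U x)].
Proof.
move=> bS c0 sS low; have lS := bS.1; have [M' M'0 hM'] := bounded_op_pos S bS.
(* Enlarging the bound of [S] beyond [c] makes [t * c = c^2 / M^2] strictly less than 1. *)
pose M := M' + c; have cM : c < M by rewrite /M; lra.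
have hM x : nrm (S x) <= M * nrm x.
  by apply: le_trans (hM' x) _; rewrite ler_wpM2r ?hnorm_ge0// /M; lra.
have M0 : 0 < M by lra.
(* This [t] minimizes [1 - 2 t c + t^2 M^2], which bounds the squared norm of [D]; the minimum is
   [1 - t c], the square of [r] below. *)
pose t := c / M ^+ 2; have t0 : 0 < t by rewrite divr_gt0// exprn_gt0.
have tM : t * M ^+ 2 = c by rewrite divfK// gt_eqF// exprn_gt0.
pose D x := x - rscale t (S x).
have tc1 : t * c < 1.
  by rewrite /t mulrAC ltr_pdivrMr ?exprn_gt0//; nra.
pose r := Num.sqrt (1 - t * c); have r0 : 0 <= r by exact: sqrtr_ge0.
have r2 : r ^+ 2 = 1 - t * c by rewrite sqr_sqrtr//; lra.
have tc0 : 0 < t * c by rewrite mulr_gt0.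
have r1 : r < 1 by nra.
have bD x : nrm (D x) <= r * nrm x.
  apply: hnorm_le; first by rewrite mulr_ge0 ?hnorm_ge0.
  rewrite exprMn r2 /D !ripE (ripC x (S x)) -!hnorm_sq.
  have a1 := ler_wpM2l (ltW t0) (low x).
  have a2 : nrm (S x) ^+ 2 <= M ^+ 2 * nrm x ^+ 2.
    by rewrite -exprMn ler_pXn2r ?nnegrE ?mulr_ge0 ?hnorm_ge0// ltW.
  have a3 := ler_wpM2l (ltW t0) (ler_wpM2l (ltW t0) a2).
  have a4 : t * (t * (M ^+ 2 * nrm x ^+ 2)) = t * (c * nrm x ^+ 2).
    by rewrite -tM; ring.
  lra.
have sD x y : ip (D x) y = ip x (D y).
  by rewrite /D ipDl ipDr ipNl ipNr ip_rscalel ip_rscaler sS.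
have [Y [q [q1 bY sY fY cY]]] := sqrt_fixpoint D r r0 r1 bD sD.
have lY : is_linear_map Y := adjoint_linear _ _ sY.
pose s := (Num.sqrt t)^-1; have st0 : 0 < Num.sqrt t by rewrite sqrtr_gt0.
have s0 : 0 < s by rewrite invr_gt0.
have s2 : s * s * t = 1.
  have e : t = Num.sqrt t * Num.sqrt t by rewrite -expr2 sqr_sqrtr// ltW.
  by rewrite [X in _ * X = _]e /s; field; rewrite gt_eqF.
pose K x := rscale s (x - Y x).
have sK x y : ip (K x) y = ip x (K y).
  by rewrite /K ip_rscalel ip_rscaler ipDl ipDr ipNl ipNr sY.
have lK : is_linear_map K := adjoint_linear _ _ sK.
have lowK x : s * (1 - q) * nrm x <= nrm (K x).
  rewrite hnorm_rscale ?(ltW s0)// -mulrA ler_pM2l//.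
  have := hnormD (x - Y x) (Y x); rewrite subrK; have := bY x; lra.
have surK y : exists x, K x = y.
  have [x hx] := neumann_surjective Y q lY q1 bY (rscale s^-1 y).
  by exists x; rewrite /K hx rscaleA mulfV ?gt_eqF// rscale1.
have sq0 : 0 < s * (1 - q) by rewrite mulr_gt0// subr_gt0.
have [L [bL KL LK]] := bounded_inverse K _ lK sq0 lowK surK.
exists K, L; split => //.
- move=> x; have -> : K (K x) = rscale s (rscale s (x - Y x - Y (x - Y x))).
    by rewrite {2}/K lin_rscale.
  (* The fixed point equation doubled, which turns [1 - 2 Y + Y^2] into [1 - D = t S]. *)
  have e : Y x + Y x = D x + Y (Y x).
    rewrite [in LHS]fY /rscale -scalerDl -[RHS]scale1r; congr (_ *: _).
    by apply: complex_ext => /=; lra.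
  have -> : x - Y x - Y (x - Y x) = x - (Y x + Y x) + Y (Y x).
    by rewrite lin_sub// opprB opprD !addrA addrAC.
  rewrite e opprD addrA subrK /D opprB addrC subrK.
  by rewrite !rscaleA s2 rscale1.
- move=> U bU US x; have lU := bU.1; rewrite /K lin_rscale// lin_sub// cY// => z.
  by rewrite /D lin_sub// lin_rscale// US.
Qed.

(** * Polar decomposition in the finite commutant *)

Lemma finite_commutant_invertible (G : Type) (pi : G -> V -> V) A B (c : R) :
  (forall g, Defs.is_unitary ip (pi g)) -> commutant_finite ip pi ->
  in_commutant ip pi A -> bounded_op ip B ->
  (forall x y, ip (A x) y = ip x (B y)) ->
  0 < c -> (forall x, c * nrm x ^+ 2 <= nrm (B x) ^+ 2) ->
  (forall y, exists x, B x = y) /\ invertible_op ip A.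
Proof.
move=> upi fin [bA cA] bB adj c0 low; have adj' := adjoint_sym _ _ adj.
have lA := bA.1; have lB := bB.1.
(* The commutant is closed under adjoints: test against [z = pi g w], which covers all vectors since
   [pi g] is onto, and cancel [pi g] by isometry. *)
have cB g y : B (pi g y) = pi g (B y).
  apply: ip_inj => z; have [[_ iso] /(_ z) [w <-]] := upi g.
  by rewrite -adj cA iso adj iso.
pose S x := A (B x).
have bS : bounded_op ip S.
  have [MA MA0 hA] := bounded_op_pos A bA; have [MB MB0 hB] := bounded_op_pos B bB.
  split=> [a x y|]; first by rewrite /S lB lA.
  exists (MA * MB) => x; apply: le_trans (hA _) _.
  by rewrite -mulrA ler_pM2l.
have sS x y : ip (S x) y = ip x (S y) by rewrite /S adj -adj'.
have lowS x : c * nrm x ^+ 2 <= rip (S x) x.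
  by rewrite /rip /S adj -/(rip _ _) -hnorm_sq.
have [K [L [bL sK KK [KL LK] cK]]] := positive_sqrt S c bS c0 sS lowS.
have cpiL g x : L (pi g x) = pi g (L x).
  have bpi : bounded_op ip (pi g) := (upi g).1.1.
  have Spi z : pi g (S z) = S (pi g z) by rewrite /S cB cA.
  by rewrite -[x in LHS]KL (cK _ bpi Spi) LK.
pose W x := B (L x).
have bW : bounded_op ip W.
  have [ML ML0 hL] := bounded_op_pos L bL; have [MB MB0 hB] := bounded_op_pos B bB.
  split=> [a x y|]; first by rewrite /W bL.1 lB.
  exists (MB * ML) => x; apply: le_trans (hB _) _.
  by rewrite -mulrA ler_pM2l.
(* Moving [B] across the pairing produces [S = K^2]; one [K] on each side cancels [L]. *)
have isoW x y : ip (W x) (W y) = ip x y.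
  by rewrite /W -adj -/(S _) -KK sK !KL.
have [_ surW] : Defs.is_unitary ip W.
  by apply: fin; split=> // g x; rewrite /W cpiL cB.
(* The range of [W = B L] lies in that of [B]: this is where finiteness yields surjectivity. *)
have surB y : exists x, B x = y by have [x <-] := surW y; exists (L x).
split=> //; split=> //; apply: (bounded_inverse A (Num.sqrt c)) => //.
- by rewrite sqrtr_gt0.
(* With [x = B z], the square of [nrm x] is [rip (A x) z], at most [nrm (A x) * nrm z], and [nrm z]
   is at most [nrm x / sqrt c]. So [A] is bounded below by [sqrt c]. *)
- move=> x; have [z hz] := surB x.
  have w0 := sqrtr_ge0 c; have w2 : Num.sqrt c ^+ 2 = c by rewrite sqr_sqrtr// ltW.
  have lowz : Num.sqrt c * nrm z <= nrm x.
    rewrite -(@ler_pXn2r _ 2) ?nnegrE ?mulr_ge0 ?hnorm_ge0//.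
    by rewrite exprMn w2 -hz.
  have [->|x0] := eqVneq (nrm x) 0; first by rewrite mulr0 hnorm_ge0.
  have xp : 0 < nrm x by rewrite lt_def x0 hnorm_ge0.
  rewrite -(ler_pM2r xp) -mulrA -expr2 hnorm_sq.
  have -> : rip x x = rip (A x) z by rewrite /rip adj hz.
  apply: le_trans (ler_wpM2l w0 (cauchy_schwarz _ _)) _.
  by rewrite mulrCA ler_wpM2l// hnorm_ge0.
(* The preimage is [B S^-1 y], with [S^-1 = L^2]. *)
- by move=> y; exists (B (L (L y))); rewrite -/(S _) -KK !KL.
Qed.

(** * Frame sums and unions of Bessel families *)

Lemma frame_sum_eq (I : choiceType) (f f' : I -> V) x x' :
  (forall j, ip x (f j) = ip x' (f' j)) -> frame_sum ip f x = frame_sum ip f' x'.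
Proof. by move=> h; apply: eq_esum => j _; rewrite h. Qed.

Lemma cabs2_ge0 (z : R[i]) : 0 <= cabs2 z.
Proof. by rewrite /cabs2 -add_Re2_Im2 /= addr_ge0 ?sqr_ge0. Qed.

(** The sum over pairs is an iterated sum with finite outer index, so the individual Bessel bounds
    add up. *)
Lemma bessel_union (k : nat) (G : choiceType) (f : 'I_k -> G -> V) :
  (forall j, is_bessel ip (f j)) -> is_bessel ip (fun p : 'I_k * G => f p.1 p.2).
Proof.
move=> /choice[b hb]; exists (\sum_j b j) => x; rewrite /frame_sum.
have -> : [set: 'I_k * G]%classic = ([set: 'I_k] `*`` (fun=> [set: G]))%classic.
  by apply/seteqP; split.
rewrite -(@esum_esum _ _ _ _ _ (fun i g => (cabs2 (ip x (f i g)))%:E)); last first.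
  by move=> *; rewrite lee_fin cabs2_ge0.
rewrite esum_fset; [|exact: finite_finset|]; last first.
  by move=> i _; apply: esum_ge0 => j _; rewrite lee_fin cabs2_ge0.
rewrite fsbig_finType big_distrl -sumEFin/=; apply: lee_sum => i _; exact: hb.
Qed.

End InnerProduct.

(** * Transfer of the frame bounds from [xi] to [eta] *)

Theorem lemma3p1 (R : realType) (V : lmodType R[i]) (ip : V -> V -> R[i])
    (G : countType) (mul : G -> G -> G) (e : G) (inv : G -> G)
    (pi : G -> V -> V) (k : nat) (xi eta : 'I_k -> V) (A : V -> V) :
  is_hilbert ip ->
  is_group mul e inv ->
  proj_unitary_rep ip mul pi ->
  commutant_finite ip pi ->
  is_frame ip (fun p : 'I_k * G => pi p.2 (xi p.1)) ->
  in_commutant ip pi A ->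
  (forall j : 'I_k, bessel_vector ip pi (eta j)) ->
  (forall j : 'I_k, xi j = A (eta j)) ->
  invertible_op ip A /\ is_frame ip (fun p : 'I_k * G => pi p.2 (eta p.1)).
Proof.
move=> [ipP ipC] _ [upi _] fin [a [b [a0 frame_xi]]] cA bes xiE.
have [B bB adj] := adjoint_exists R V ip ipP ipC A cA.1.
have [b' bes'] := bessel_union R V ip k G (fun j g => pi g (eta j)) bes.
(* [A] commutes with [pi g], so it moves across the pairing as [B]. *)
have fsE x : frame_sum ip (fun p : 'I_k * G => pi p.2 (xi p.1)) x =
             frame_sum ip (fun p : 'I_k * G => pi p.2 (eta p.1)) (B x).
  by apply: frame_sum_eq => p; rewrite xiE -cA.2 -(adjoint_sym R V ip ipP A B adj).
(* A strictly positive Bessel bound for the union, safe to divide by. *)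
pose d := `|b'| + 1; have d0 : 0 < d by rewrite ltr_wpDl.
have low x : a / d * hnorm ip x ^+ 2 <= hnorm ip (B x) ^+ 2.
  rewrite mulrAC ler_pdivrMr// mulrC.
  have := (frame_xi x).1; rewrite fsE => /le_trans/(_ (bes' (B x))).
  rewrite lee_fin mulrC => /le_trans; apply; rewrite mulrC ler_wpM2l ?sqr_ge0//.
  by rewrite /d; have := ler_norm b'; lra.
have ad0 : 0 < a / d by rewrite divr_gt0.
have [surB invA] :=
  finite_commutant_invertible R V ip ipP ipC G pi A B _ upi fin cA bB adj ad0 low.
split=> //; have [M M0 hM] := bounded_op_pos R V ip B bB.
(* For [x = B z], boundedness of [B] gives [nrm z >= nrm x / M], hence the lower bound; [low] bounds
   [nrm z ^ 2] by [nrm x ^ 2 / (a / d)], hence the upper one. The absolute value is there because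
   [b] has no prescribed sign. *)
exists (a / M ^+ 2), (`|b| / (a / d)); split; first by rewrite divr_gt0// exprn_gt0.
move=> x; have [z <-] := surB x; rewrite -fsE; have [h1 h2] := frame_xi z.
split.
  apply: le_trans h1; rewrite lee_fin mulrAC -mulrA ler_pM2l// ler_pdivrMr ?exprn_gt0//.
  rewrite mulrC -exprMn ler_pXn2r ?nnegrE ?mulr_ge0 ?hnorm_ge0// ltW//.
apply: le_trans h2 _; rewrite lee_fin.
apply: (@le_trans _ _ (`|b| * hnorm ip z ^+ 2)).
  by rewrite ler_wpM2r ?sqr_ge0// ler_norm.
by rewrite -mulrA ler_wpM2l// mulrC ler_pdivlMr// mulrC.
Qed.
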